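(* Let $s,n,k,\ell,L\ge 1$ be integers with $2\le\ell\le L$, let $\mathbb{F}_q$ be a finite field with $q\ge\ell$ and $q>sn>k$, let $\gamma$ be a generator of $\mathbb{F}_q^\times$, and let $m=\lceil\log_\ell(L+1)\rceil$, so $m>1$. Put $R=\frac{k}{sn}$ and suppose that $R\le\frac{m-1}{m}$ and $\frac{k-1}{s}\ge m$. Let $(\alpha_1,\dots,\alpha_n)\in\mathbb{F}_q^n$ be appropriate. If the folded Reed--Solomon code $\mathsf{FRS}^{(s,\gamma)}_{n,k}(\alpha_1,\dots,\alpha_n)$ is $(\rho,\ell,L)$ list-recoverable, then $$\rho\le\frac{L+1-\ell}{L+1}\left(1-\frac{mR}{m-1}\right)+\frac{5}{n}.$$
   Context: Appropriate: $(\alpha_1,\dots,\alpha_n)\in\mathbb{F}_q^n$ is appropriate (with respect to $s$ and the generator $\gamma$) if the $sn$ elements $\gamma^i\alpha_j$, $i\in\{0,\dots,s-1\}$, $j\in\{1,\dots,n\}$, are pairwise distinct. Folded Reed--Solomon code: $\mathsf{FRS}^{(s,\gamma)}_{n,k}(\alpha_1,\dots,\alpha_n)=\{\mathcal{C}(f): f\in\mathbb{F}_q[x],\ \deg f<k\}\subseteq(\mathbb{F}_q^s)^n$, where $\mathcal{C}(f)=(F_1,\dots,F_n)$ and $F_i=(f(\alpha_i),f(\gamma\alpha_i),\dots,f(\gamma^{s-1}\alpha_i))\in\mathbb{F}_q^s$. Its rate is $R=\frac{k}{sn}$. List-recoverability: for $\rho\in[0,1]$, a code $C\subseteq\Sigma^n$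 is $(\rho,\ell,L)$ list-recoverable if for all subsets $S_1,\dots,S_n\subseteq\Sigma$ with $|S_i|\le\ell$ for every $i$, there are at most $L$ codewords $c\in C$ such that the number of indices $i\in\{1,\dots,n\}$ with $c_i\notin S_i$ is at most $\rho n$. *)

(* Defs.v *)
From HB Require Import structures.
From mathcomp Require Import all_boot all_order all_algebra all_fingroup all_solvable.
From mathcomp Require Import reals exp.

Set Implicit Arguments.
Unset Strict Implicit.
Unset Printing Implicit Defensive.

Import Order.TTheory GRing.Theory Num.Theory.
Local Open Scope ring_scope.

Section FoldedReedSolomon.

Variables (F : finFieldType) (s n : nat) (gamma : F) (alpha : 'I_n -> F).

Definition appropriate : Prop :=
  injective (fun ij : 'I_s * 'I_n => gamma ^+ ij.1 * alpha ij.2).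

Definition frs_encode (f : {poly F}) : {ffun 'I_n -> 'rV[F]_s} :=
  [ffun j => \row_(i < s) f.[gamma ^+ i * alpha j]].

(* [{poly_k F}] is the finite type of polynomials [f] with [size f <= k],
   that is, [deg f < k], the zero polynomial included. *)
Definition FRS (k : nat) : {set {ffun 'I_n -> 'rV[F]_s}} :=
  [set frs_encode f | f : {poly_k F}].

End FoldedReedSolomon.

Definition frs_rate (K : realType) (s n k : nat) : K := k%:R / (s * n)%:R.

Definition list_recoverable (K : realType) (Sigma : finType) (n : nat)
    (C : {set {ffun 'I_n -> Sigma}}) (rho : K) (l L : nat) : Prop :=
  forall S : 'I_n -> {set Sigma},
    (forall i, (#|S i| <= l)%N) ->
    (#|[set c in C | (#|[set i | c i \notin S i]|%:R <= rho * n%:R)%R]| <= L)%N.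

(* Main.v *)
(** Split [t] of the [n] folded positions cyclically into [m] classes, and let [f_j]
    be the product of the linear factors vanishing at the positions outside class [j].
    The [l ^ m > L] combinations [\sum_j a_j f_j], with coefficients in a fixed set of
    size [l], take at most [l] values at each of these positions, where only one [f_j]
    survives.  On the other [n - t] positions, choose [l] of [L + 1] such codewords in
    cyclic order, so that each of them is missed on about a fraction
    [(L + 1 - l) / (L + 1)] of the positions.  The degree bound allows
    [t >= n (m R / (m - 1)) - 3]. *)
Require Import Defs.
From HB Require Import structures.
From mathcomp Require Import all_boot all_order all_algebra all_fingroup all_solvable.
From mathcomp Require Import reals exp.
From mathcomp Require Import zify ring lra.

Set Implicit Arguments.
Unset Strict Implicit.
Unset Printing Implicit Defensive.

Import Order.TTheory GRing.Theory Num.Theory.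
Local Open Scope ring_scope.

(** * Covering residues by cyclic blocks *)

(* The residue [i] lies in the [u]-th of the consecutive blocks of length [l] that wrap
   around the integers modulo [p]. *)
Definition window (p l u i : nat) : bool :=
  [exists x : 'I_l, (u * l + x) %% p == i]%N.

(** The first [N] blocks list the integers below [N * l] in order, and as [l <= p] each block holds
    at most one congruent to [i]; the quotient counts these integers. *)
Lemma window_countP (p l N i : nat) : (l <= p)%N -> (i < p)%N ->
  ((N * l + (p - i.+1)) %/ p <= \sum_(u < N) window p l u i)%N.
Proof.
move=> lep ltip; elim: N => [|N IH]; first by rewrite big_ord0 divn_small //; lia.
rewrite big_ord_recr /=.
have [hit|/existsPn miss] := boolP (window p l N i).
  apply: leq_trans (leq_add IH (leqnn 1%N)).
  rewrite -divnDMl ?mul1n; last by lia.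
  by apply: leq_div2r; lia.
rewrite addn0; apply: leq_trans IH.
(* If the quotient grew to [q], the integer [(q - 1) * p + i] would lie in block [N], which was
   assumed to miss [i]. *)
rewrite leqNgt; apply/negP; set q := ((N.+1 * l + _) %/ p)%N => ltq.
have q1 : (q * p <= N.+1 * l + (p - i.+1))%N by apply: leq_trunc_div.
have q2 : (N * l + (p - i.+1) < q * p)%N.
  by rewrite -ltn_divLR //; lia.
have q0 : (0 < q)%N by apply: leq_ltn_trans ltq.
have qE : (q * p = q.-1 * p + p)%N by rewrite -{1}(prednK q0) mulSn addnC.
have xP : (q.-1 * p + i - N * l < l)%N by lia.
have /eqP[] := miss (Ordinal xP); rewrite /=.
have -> : (N * l + (q.-1 * p + i - N * l) = q.-1 * p + i)%N by lia.
by rewrite modnMDl modn_small.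
Qed.

(** The floor in the count of hits loses at most [p - 1], which the offset [p - i.+1] reduces to an
    error of [i]. *)
Lemma window_missP (p l N i : nat) : (l <= p)%N -> (i < p)%N ->
  (p * \sum_(u < N) ~~ window p l u i <= N * (p - l) + i)%N.
Proof.
move=> lep ltip; have hits := window_countP N lep ltip.
have tot : (\sum_(u < N) ~~ window p l u i + \sum_(u < N) window p l u i = N)%N.
  rewrite -big_split /= -[RHS]card_ord -sum1_card.
  by apply: eq_bigr => u _; case: window.
have := divn_eq (N * l + (p - i.+1)) p.
have : ((N * l + (p - i.+1)) %% p < p)%N by rewrite ltn_pmod; lia.
move: hits tot; set a := (\sum_(u < N) ~~ _)%N; set b := (\sum_(u < N) _)%N.
set q := (_ %/ p)%N; nia.
Qed.

(** Blocks of length 1 are single residues, so this is the case [l = 1] of the block count. It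
    bounds the number of positions where one [f_j] must vanish. *)
Lemma card_residue_miss (m t j : nat) : (j < m)%N ->
  (\sum_(u < t) (u %% m != j) <= t - t %/ m)%N.
Proof.
move=> ltjm; have m0 : (0 < m)%N by lia.
have -> : (\sum_(u < t) (u %% m != j) = \sum_(u < t) ~~ window m 1 u j)%N.
  apply: eq_bigr => u _; congr (nat_of_bool (~~ _)).
  apply/eqP/existsP => [E | [x /eqP]].
    by exists ord0; rewrite muln1 addn0 E.
  by rewrite muln1 (ord1 x) addn0.
have := window_missP t m0 ltjm.
set a := (\sum_(u < t) _)%N => le_a.
have := divn_eq t m; have := ltn_pmod t m0.
move: le_a; set q := (t %/ m)%N; set r := (t %% m)%N => le_a ltr tE.
have : (m * a <= m * (t - q) + (m.-1))%N.
  rewrite mulnBr; nia.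
by move=> H; rewrite -ltnS -(ltn_pmul2l m0); nia.
Qed.

Lemma card_ord_truncate (n t : nat) (P : pred nat) : (t <= n)%N ->
  #|[set u : 'I_n | P u && (u < t)%N]| = (\sum_(u < t) P u)%N.
Proof.
move=> letn; rewrite -sum1_card (eq_bigl (fun u : 'I_n => P u && (u < t)%N)).
  rewrite -(big_ord_widen_cond n P (fun=> 1%N)) // big_mkcond.
  by apply: eq_bigr => u _; case: (P u).
by move=> u; rewrite inE.
Qed.

Lemma card_ord_shift (n t : nat) (P : pred nat) : (t <= n)%N ->
  #|[set u : 'I_n | (t <= u)%N && P (u - t)%N]| = (\sum_(u < n - t) P u)%N.
Proof.
move=> letn; rewrite -sum1_card (eq_bigl (fun u : 'I_n => (t <= u)%N && P (u - t)%N)).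
  rewrite big_mkcond /=.
  rewrite -(big_mkord xpredT (fun u => if (t <= u)%N && P (u - t)%N then 1 else 0)%N).
  rewrite (@big_cat_nat _ _ _ t) //= big_nat_cond big1 ?add0n; last first.
    by move=> u; case: leqP => //; lia.
  rewrite -{1}[t]add0n big_addn big_mkord.
  by apply: eq_bigr => u _; rewrite leq_addl addnK; case: (P u).
by move=> u; rewrite inE.
Qed.

(** * Polynomials vanishing on sets of folded positions *)

Section Locator.

Variables (F : finFieldType) (s n : nat) (gamma : F) (alpha : 'I_n -> F).

Definition folded_locator (P : pred 'I_n) : {poly F} :=
  \prod_(j | P j) \prod_(i < s) ('X - (gamma ^+ i * alpha j)%:P).

Lemma size_folded_locator P : size (folded_locator P) = (s * #|P|).+1.
Proof.
have size_block j : size (\prod_(i < s) ('X - (gamma ^+ i * alpha j)%:P)) = s.+1.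
  by rewrite size_prod_XsubC /index_enum -enumT size_enum_ord.
rewrite size_prod; last by move=> j _; rewrite -size_poly_eq0 size_block.
by rewrite (eq_bigr (fun=> s.+1)) // sum_nat_const mulnS -addnS addKn mulnC.
Qed.

Lemma folded_locator_eq0 (P : pred _) (i : 'I_s) j : P j ->
  (folded_locator P).[gamma ^+ i * alpha j] = 0.
Proof.
by move=> Pj; rewrite /folded_locator (bigD1 j) //= (bigD1 i) //= !hornerE subrr !mul0r.
Qed.

(** Appropriateness separates the points of a position outside [P] from all the roots. *)
Lemma folded_locator_neq0 (P : pred _) (i : 'I_s) j : appropriate s gamma alpha ->
  ~~ P j -> (folded_locator P).[gamma ^+ i * alpha j] != 0.
Proof.
move=> app Pj; rewrite horner_prod; apply/prodf_neq0 => j' Pj'.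
rewrite horner_prod; apply/prodf_neq0 => i' _.
rewrite !hornerE subr_eq0; apply: contra Pj => /eqP E.
by have [_ ->] := app (i, j) (i', j') E.
Qed.

End Locator.

Lemma frs_encodeE (F : finFieldType) (s n : nat) (gamma : F) (alpha : 'I_n -> F)
    (f : {poly F}) (u : 'I_n) (i : 'I_s) :
  frs_encode s gamma alpha f u 0 i = f.[gamma ^+ i * alpha u].
Proof. by rewrite ffunE mxE. Qed.

(** At most [t - t %/ m] of the first [t] positions lie outside a given class, so [s * (t - t %/ m)]
    bounds the degree of every combination. The final [+ L] is the rounding error of the cyclic
    choice. *)
Lemma frs_many_close_codewords (F : finFieldType) (s n k l L m t : nat)
    (gamma : F) (alpha : 'I_n -> F) :
  appropriate s gamma alpha -> (0 < s)%N -> (0 < m)%N -> (m <= t <= n)%N ->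
  (s * (t - t %/ m) < k)%N -> (l <= L.+1)%N -> (l <= #|F|)%N -> (L < l ^ m)%N ->
  exists c : 'I_L.+1 -> {ffun 'I_n -> 'rV[F]_s}, exists S : 'I_n -> {set 'rV[F]_s},
    [/\ injective c, forall i, c i \in FRS s gamma alpha k,
        forall u, (#|S u| <= l)%N
      & forall i, (L.+1 * #|[set u | c i u \notin S u]|
                   <= (n - t) * (L.+1 - l) + L)%N].
Proof.
move=> app s0 m0 /andP[le_mt le_tn] size_lt le_lL le_lF lt_L.
pose A (x : 'I_l) : F := enum_val (widen_ord le_lF x).
have A_inj : injective A.
  by move=> x y /enum_val_inj /(congr1 val) /= ?; apply: val_inj.
have card_digits : (L.+1 <= #|{ffun 'I_m -> 'I_l}|)%N by rewrite card_ffun !card_ord.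
pose digit (i : 'I_L.+1) : {ffun 'I_m -> 'I_l} := enum_val (widen_ord card_digits i).
have digit_inj : injective digit.
  by move=> x y /enum_val_inj /(congr1 val) /= ?; apply: val_inj.
pose zeros (j : 'I_m) : pred 'I_n := fun u => (u %% m != j)%N && (u < t)%N.
pose f j := folded_locator s gamma alpha (zeros j).
pose w i := \sum_(j < m) A (digit i j) *: f j.
pose c i := frs_encode s gamma alpha (w i).
pose res u : 'I_m := Ordinal (ltn_pmod u m0).
have wE i (u : 'I_n) (x : 'I_s) : (u < t)%N ->
    (w i).[gamma ^+ x * alpha u] =
    A (digit i (res u)) * (f (res u)).[gamma ^+ x * alpha u].
  move=> lt_ut; rewrite /w horner_sum (bigD1 (res u)) //= hornerZ big1 ?addr0 // => j jP.
  rewrite hornerZ folded_locator_eq0 ?mulr0 // /zeros lt_ut andbT.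
  by apply: contra jP => /eqP E; apply/eqP/val_inj.
(* From [t] on, the codewords listed at [u] have indices in a block modulo [L.+1]; the reduction
   keeps [inord] away from its default value. *)
pose S (u : 'I_n) : {set 'rV[F]_s} :=
  if (u < t)%N then [set A x *: frs_encode s gamma alpha (f (res u)) u | x : 'I_l]
  else [set c (inord (((u - t) * l + x) %% L.+1)) u | x : 'I_l].
exists c, S; split.
- move=> i i' cE; apply: digit_inj; apply/ffunP => j; apply: A_inj.
  (* Position [j] lies in class [j], and [m <= t] puts it among the first [t]. Its first coordinate
     is the coefficient of [f j] times a nonzero value, so digit [j] can be read off. *)
  have ltjt := leq_trans (ltn_ord j) le_mt.
  pose u := Ordinal (leq_trans ltjt le_tn).
  have resE : res u = j by apply: val_inj; rewrite /= modn_small.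
  have := congr1 (fun g : {ffun 'I_n -> 'rV[F]_s} => g u 0 (Ordinal s0)) cE.
  rewrite /= !frs_encodeE !wE // resE => /mulIf; apply.
  by apply: folded_locator_neq0; rewrite // /zeros /= modn_small // eqxx.
- move=> i; apply/imsetP; exists (npolyp k (w i)) => //.
  rewrite npolypK // (leq_trans (size_sum _ _ _)) //.
  apply/bigmax_leqP => j _; rewrite (leq_trans (size_scale_leq _ _)) //.
  rewrite size_folded_locator (leq_ltn_trans _ size_lt) // leq_mul2l.
  rewrite -(cardsE (zeros j)) (card_ord_truncate (fun u => u %% m != j)%N le_tn).
  by rewrite card_residue_miss ?orbT.
- move=> u; rewrite /S; case: ifP => _; rewrite (leq_trans (leq_imset_card _ _)) //;
  by rewrite card_ord.
- move=> i.
  (* Misses occur only from [t] on, where the block of [u - t] leaves out [i]; the rounding term [i]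
     is at most [L]. *)
  apply: leq_trans (_ : L.+1 * \sum_(u < n - t) ~~ window L.+1 l u i <= _)%N; last first.
    by rewrite (leq_trans (window_missP _ le_lL (ltn_ord i))) // leq_add2l -ltnS.
  rewrite leq_mul2l /= -(card_ord_shift (fun u => ~~ window L.+1 l u i) le_tn).
  apply/subset_leq_card/subsetP => u; rewrite !inE /S; case: ltnP => [lt_ut | le_tu] /=.
    case/imsetP; exists (digit i (res u)) => //; apply/rowP => x.
    by rewrite frs_encodeE wE // mxE frs_encodeE.
  apply: contra => /existsP[x /eqP xE]; apply/imsetP; exists x => //.
  by rewrite xE inord_val.
Qed.

(** * Arithmetic of the parameters *)

(* With [d] common zeros available to each of [m] polynomials, [t] is the largest
   number of positions at which all but one of them can vanish. *)
Lemma zero_budget_split (d m : nat) (t := (d + d %/ (m - 1))%N) : (1 < m)%N ->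
  [/\ (t - t %/ m)%N = d, (d <= t)%N, ((m - 1) * t <= m * d)%N
     & (m * d.+1 <= (m - 1) * (t + 3))%N].
Proof.
case: m @t => [|[|a]] // t _; rewrite subn1 /= in t *.
have dE := divn_eq d a.+1; have lt_r := ltn_pmod d (ltn0Sn a).
rewrite /t; move: (d %/ _)%N (d %% _)%N dE lt_r => g r -> {d t} lt_r.
(* Here [m = a + 2] and [d = g * (m - 1) + r] with [r < m - 1]; thus [t = g * m + r] and
   [t %/ m = g]. *)
have -> : (g * a.+1 + r + g = g * a.+2 + r)%N by nia.
rewrite divnMDl // (divn_small (leqW lt_r)) addn0.
by split; nia.
Qed.

(** With [p = L + 1] this gives enough digit vectors of length [m] to label all the codewords. *)
Lemma ceil_log_le (K : realType) (l p m : nat) : (1 < l)%N -> (0 < p)%N ->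
  m%:Z = Num.ceil (ln p%:R / ln l%:R :> K) -> (p <= l ^ m)%N.
Proof.
move=> l1 p0 mE.
have ln_l : 0 < ln (l%:R : K) by rewrite ln_gt0 // ltr1n.
have : ln p%:R / ln l%:R <= m%:R :> K.
  by rewrite -[m%:R]/(m%:Z%:~R) mE ceil_ge.
rewrite ler_pdivrMr // mulr_natl -lnXn ?ltr0n; last by lia.
by rewrite ler_ln ?posrE ?exprn_gt0 ?ltr0n ?(ltnW l1) // -natrX ler_nat.
Qed.

Lemma ceil_log_gt1 (K : realType) (l p m : nat) : (1 < l < p)%N ->
  m%:Z = Num.ceil (ln p%:R / ln l%:R :> K) -> (1 < m)%N.
Proof.
move=> /andP[l1 lp] mE.
have ln_l : 0 < ln (l%:R : K) by rewrite ln_gt0 // ltr1n.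
have : 1 < ln p%:R / ln l%:R :> K.
  by rewrite ltr_pdivlMr // mul1r ltr_ln ?posrE ?ltr0n ?ltr_nat //; lia.
move=> /lt_le_trans/(_ (ceil_ge _)); rewrite -mE.
by rewrite -[_%:~R]/(m%:R) ltr1n.
Qed.

Theorem theorem1p7 (K : realType) (F : finFieldType) (s n k l L m : nat)
    (gamma : {unit F}) (alpha : 'I_n -> F) (R rho : K)
    (s_ge1 : (1 <= s)%N) (n_ge1 : (1 <= n)%N) (k_ge1 : (1 <= k)%N)
    (l_ge2 : (2 <= l)%N) (l_le_L : (l <= L)%N)
    (l_le_q : (l <= #|F|)%N) (sn_lt_q : (s * n < #|F|)%N)
    (k_lt_sn : (k < s * n)%N)
    (gamma_gen : generator [set: {unit F}] gamma)
    (mE : m%:Z = Num.ceil (ln (L + 1)%:R / ln l%:R :> K))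
    (RE : R = frs_rate K s n k)
    (R_le : R <= (m%:R - 1) / m%:R)
    (m_le : m%:R <= (k%:R - 1) / s%:R :> K)
    (alpha_app : appropriate s (val gamma) alpha)
    (rho01 : 0 <= rho <= 1)
    (C_lr : list_recoverable (FRS s (val gamma) alpha k) rho l L) :
  rho <= (L%:R + 1 - l%:R) / (L%:R + 1) * (1 - m%:R * R / (m%:R - 1))
         + 5%:R / n%:R.
Proof.
have m1 : (1 < m)%N by apply: (ceil_log_gt1 _ mE); lia.
have lt_L : (L < l ^ m)%N.
  by have := ceil_log_le l_ge2 _ mE; rewrite addn1; apply.
(* [d] is the largest number of whole folded positions whose linear factors fit in degree
   [k - 1]. *)
pose d := ((k - 1) %/ s)%N.
pose t := (d + d %/ (m - 1))%N.
have s_gt0 : 0 < s%:R :> K by rewrite ltr0n.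
have n_gt0 : 0 < n%:R :> K by rewrite ltr0n.
have m1_gt0 : 0 < m%:R - 1 :> K by rewrite subr_gt0 ltr1n.
have m_gt0 : 0 < m%:R :> K by rewrite ltr0n; lia.
have predR (x : nat) : (1 <= x)%N -> x%:R - 1 = (x - 1)%:R :> K by move=> /natrB ->.
have le_md : (m <= d)%N.
  move: m_le; rewrite ler_pdivlMr // predR // -natrM ler_nat => le_ms.
  by rewrite leq_divRL.
have mk_le : (m * k <= (m - 1) * (s * n))%N.
  move: R_le; rewrite RE /frs_rate ler_pdivrMr ?ltr0n ?muln_gt0 ?s_ge1 //.
  rewrite mulrAC ler_pdivlMr // predR ?(ltnW m1) // -!natrM ler_nat mulnC.
  by [].
have m1_pos : (0 < m - 1)%N by rewrite subn_gt0.
have le_ks : (k <= s * d.+1)%N.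
  by have := ltn_ceil (k - 1) s_ge1; rewrite -/d mulnC subn1 prednK.
have le_sd : (s * d < k)%N.
  by rewrite -[k in (_ < k)%N](subnK k_ge1) addn1 ltnS mulnC leq_trunc_div.
have [tm dt le_td lt_dt] := zero_budget_split d m1; rewrite -/t in tm dt le_td lt_dt.
have le_tn : (t <= n)%N.
  (* Combines [(m - 1) * t <= m * d], [s * d < k] and the rate bound [mk_le]. *)
  rewrite -(leq_pmul2l m1_pos) -(leq_pmul2l s_ge1).
  apply: leq_trans (leq_mul (leqnn s) le_td) _.
  rewrite mulnCA [leqRHS]mulnCA; apply: leq_trans mk_le.
  by rewrite leq_mul2l (ltnW le_sd) orbT.
have [||||c [S [c_inj c_code S_le c_close]]] :=
    @frs_many_close_codewords F s n k l L m t (val gamma) alpha alpha_app s_ge1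
      _ _ _ _ l_le_q lt_L.
- by lia.
- by rewrite le_tn andbT (leq_trans le_md).
- by rewrite tm.
- by lia.
(* Were [rho] larger, all [L + 1] constructed codewords would lie within the radius, against
   list-recoverability. *)
rewrite leNgt; apply/negP => rho_gt.
suff : (L.+1 <= L)%N by rewrite ltnn.
apply: leq_trans (C_lr S S_le).
rewrite -[X in (X <= _)%N](card_ord L.+1) -(card_imset _ c_inj).
apply/subset_leq_card/subsetP => _ /imsetP[i _ ->]; rewrite inE c_code /=.
have : (L.+1 * #|[set u | c i u \notin S u]|)%:R <= ((n - t) * (L.+1 - l) + L)%:R :> K.
  by rewrite ler_nat.
set D := #|_|; rewrite natrM natrD natrM !natrB ?(leqW l_le_L) //.
have L1_gt0 : 0 < L.+1%:R :> K by rewrite ltr0n.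
rewrite mulrC -ler_pdivlMr // => /le_trans; apply.
(* The floors in [d] and [t] together cost at most 3 positions. *)
have t_ge : n%:R * (m%:R * R / (m%:R - 1)) - 3 <= t%:R :> K.
  have kt : (m * k <= s * (m - 1) * (t + 3))%N.
    apply: leq_trans (leq_mul (leqnn m) le_ks) _.
    by rewrite mulnCA -mulnA leq_mul2l lt_dt orbT.
  rewrite RE /frs_rate lerBlDr natrM.
  have -> : n%:R * (m%:R * (k%:R / (s%:R * n%:R)) / (m%:R - 1)) =
            (m * k)%:R / (s * (m - 1))%:R :> K.
    rewrite !natrM natrB ?(ltnW m1) //.
    by field; apply/and3P; split; rewrite gt_eqF.
  rewrite ler_pdivrMr ?ltr0n ?muln_gt0 ?s_ge1 ?subn_gt0 //.
  by rewrite -natrD -natrM ler_nat [leqRHS]mulnC.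
set X := m%:R * R / (m%:R - 1) in rho_gt t_ge.
rewrite !natr1 in rho_gt.
set theta : K := (L.+1%:R - l%:R) / L.+1%:R in rho_gt.
have : theta * (n%:R - n%:R * X) + 5%:R <= rho * n%:R.
  apply: le_trans (ler_wpM2r (ltW n_gt0) (ltW rho_gt)).
  by rewrite mulrDl divfK ?gt_eqF // lerD2r le_eqVlt; apply/orP; left; apply/eqP; ring.
apply: le_trans.
rewrite mulrDl -mulrA [X in X + _]mulrC -/theta.
(* As [theta <= 1], the 3 positions lost in [t] and the rounding term [L / (L + 1)] cost at most 4,
   within the 5 of the bound. *)
have theta0 : 0 <= theta by rewrite divr_ge0 ?subr_ge0 ?ler_nat ?(leqW l_le_L).
have theta1 : theta <= 1 by rewrite ler_pdivrMr // mul1r gerBl ler0n.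
have ratio1 : L%:R / L.+1%:R <= 1 :> K by rewrite ler_pdivrMr // mul1r ler_nat.
apply: le_trans (lerD (lexx _) ratio1) _.
have : theta * (n%:R - t%:R) <= theta * (n%:R - n%:R * X + 3).
  by apply: ler_wpM2l => //; lra.
rewrite mulrDr => theta_t; clearbody theta X; lra.
Qed.
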